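(* Let $p$ be a prime, let $\mathfrak A(s_0)=\langle\mathbb F_p,\mathcal S,\mathbb F_p,S,O,s_0\rangle$ be an automaton, and let $f=f_{\mathfrak A(s_0)}\colon\mathbb Z_p\to\mathbb Z_p$ be its automaton function. Then the following alternative holds: either $\alpha(f)=0$ (equivalently, $\mathcal E(f)$ is nowhere dense in $\mathbb I^2$), or $\alpha(f)=1$ (equivalently, $\mathcal E(f)=\mathbb I^2$).
   Context: Throughout, $\mathbb F_p=\{0,1,\ldots,p-1\}$ is used as an alphabet, and $\mathbb Z_p$ is the space of $p$-adic integers; $x=\sum_{i\ge 0}\chi_i p^i\in\mathbb Z_p$ (with $\chi_i\in\mathbb F_p$) is identified with the infinite word with letters $\chi_0,\chi_1,\chi_2,\ldots$. Automaton: a tuple $\mathfrak A(s_0)=\langle\mathbb F_p,\mathcal S,\mathbb F_p,S,O,s_0\rangle$ where $\mathcal S$ is a non-empty, possibly infinite, set of states, $S\colon\mathbb F_p\times\mathcal S\to\mathcal S$ is the state transition function, $O\colon\mathbb F_p\times\mathcal S\to\mathbb F_p$ is the output function, and $s_0\in\mathcal S$ is the initial state. It is assumed that every state is reachable from $s_0$, i.e. every $s\in\mathcal S$ is the state reached from $s_0$ after feeding some finite input word. Automaton function: for an input $x=\sum_{i\ge0}\chi_ip^i$ put $s_{i+1}=S(\chi_i,s_i)$ and $\xi_i=O(\chi_i,s_i)$ for $i=0,1,2,\ldots$ (starting from the initial state $s_0$); then $f_{\mathfrak A(s_0)}(x)=\sum_{i\ge0}\xi_ip^i$. For $x=\sum_{i\ge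 0}\chi_ip^i\in\mathbb Z_p$ and $k\ge1$, $x\bmod p^k=\sum_{i=0}^{k-1}\chi_ip^i\in\{0,1,\ldots,p^k-1\}$. Let $\mathbb I^2=[0,1]\times[0,1]\subset\mathbb R^2$. For $f\colon\mathbb Z_p\to\mathbb Z_p$ and $k\in\{1,2,3,\ldots\}$ let $$E_k(f)=\left\{\left(\frac{x\bmod p^k}{p^k},\frac{f(x)\bmod p^k}{p^k}\right)\colon x\in\mathbb Z_p\right\}\subset\mathbb I^2,\qquad E(f)=\bigcup_{k=1}^\infty E_k(f).$$ $\mathcal E(f)$ denotes the closure of $E(f)$ in the usual topology of $\mathbb R^2$, and $\alpha(f)$ denotes the Lebesgue measure of $\mathcal E(f)$. *)

(* Defs.v *)
From mathcomp Require Import all_boot all_order all_algebra.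
From mathcomp Require Import all_classical all_reals all_analysis.

Set Implicit Arguments.
Unset Strict Implicit.
Unset Printing Implicit Defensive.

Import Order.TTheory GRing.Theory Num.Theory.
Import numFieldNormedType.Exports.

Local Open Scope classical_set_scope.
Local Open Scope ring_scope.

(* [padic_int p] is Z_p: x = \sum_i (x i) p^i is represented by the infinite
   word of its base-p digits, each p-adic integer having exactly one. *)
Definition padic_int (p : nat) : Type := nat -> 'I_p.

Definition padic_mod (p k : nat) (x : padic_int p) : nat :=
  (\sum_(i < k) x i * p ^ i)%N.

Record automaton (p : nat) := Automaton {
  state : Type;
  trans : 'I_p -> state -> state;
  out : 'I_p -> state -> 'I_p;
  init : state;
  reachable : forall s : state,
    exists w : seq 'I_p, s = foldl (fun t c => trans c t) init w
}.

Fixpoint state_at (p : nat) (A : automaton p) (x : padic_int p) (i : nat)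
    : state A :=
  if i is j.+1 then trans (x j) (state_at A x j) else init A.

Definition automaton_fun (p : nat) (A : automaton p) (x : padic_int p)
    : padic_int p :=
  fun i => out (x i) (state_at A x i).

Definition unit_square (R : realType) : set (R * R) := `[0, 1] `*` `[0, 1].
Arguments unit_square R _ : clear implicits.

Definition plot_at (R : realType) (p : nat) (f : padic_int p -> padic_int p)
    (k : nat) : set (R * R) :=
  range (fun x : padic_int p =>
    ((padic_mod k x)%:R / (p ^ k)%:R, (padic_mod k (f x))%:R / (p ^ k)%:R)).
Arguments plot_at R {p} f k _.

Definition plot (R : realType) (p : nat) (f : padic_int p -> padic_int p)
    : set (R * R) :=
  \bigcup_(k in [set k | (0 < k)%N]) plot_at R f k.
Arguments plot R {p} f _.

Definition closed_plot (R : realType) (p : nat)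
    (f : padic_int p -> padic_int p) : set (R * R) :=
  closure (plot R f).
Arguments closed_plot R {p} f _.

Definition alpha (R : realType) (p : nat) (f : padic_int p -> padic_int p)
    : \bar R :=
  (@lebesgue_measure R \x @lebesgue_measure R)%E (closed_plot R f).

Definition nowhere_dense (T : topologicalType) (A : set T) : Prop :=
  (closure A)^° = set0.

(* The ambient space is the subtype [set_type X], which carries the topology
   induced by [T]. *)
Definition nowhere_dense_in (T : topologicalType) (X A : set T) : Prop :=
  nowhere_dense ((set_val : set_type X -> T) @^-1` A).

(* Main.v *)
Require Import Defs.
From mathcomp Require Import all_boot all_order all_algebra.
From mathcomp Require Import all_classical all_reals all_analysis.
From mathcomp Require Import measurable_realfun.
From mathcomp Require Import lra.
Import numFieldNormedType.Exports.

(** The later a digit is read, the more significant it is.  Hence, up to an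
    error of p^-n, a plotted point of level at least n depends only on the last
    n input and output digits, that is, on what the automaton does during n
    consecutive steps from some state.  Call a pair (i, j) of residues modulo
    p^n a window if some state turns the n digits of i into those of j; as every
    state is reachable, the windows are exactly the half-open grid squares of
    side p^-n that contain a point plotted at level n or above.

    If for every n all p^(2n) pairs are windows, every grid square contains a
    plotted point, so the plot is dense ([closed_plot_full]).  Otherwise some
    n has only c < p^(2n) windows.  Cutting a window of length m * n into m
    blocks gives m windows of length n ([windowD]), so there are at most c^m
    of them ([card_windowsM]).  The plot is thus covered by c^m squares of side
    p^-(m * n) and the finitely many points of lower level, and its closure has
    measure at most (c / p^(2n))^m, which tends to 0 ([alpha_eq0]).

    This dichotomy yields both characterisations: the square has measure 1 and
    is not nowhere dense in itself, while a closed set with nonempty interior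
    in the square contains a rectangle of positive area
    ([null_nowhere_dense_in_square]). *)

Set Implicit Arguments.
Unset Strict Implicit.
Unset Printing Implicit Defensive.

Import Order.TTheory GRing.Theory Num.Theory.
Local Open Scope classical_set_scope.
Local Open Scope ring_scope.

(** * Windows of an automaton *)

Section Windows.
Local Open Scope nat_scope.
Context (p : nat) (A : automaton p).
Implicit Types (s : state A) (x y : padic_int p) (k m n i j : nat).

Fixpoint state_from s x i : state A :=
  if i is j.+1 then trans (x j) (state_from s x j) else s.

Definition run s x : padic_int p := fun i => out (x i) (state_from s x i).

Definition drop_digits m x : padic_int p := fun i => x (m + i).

Lemma automaton_funE x : automaton_fun A x = run (init A) x.
Proof.
apply/funext => i; rewrite /automaton_fun /run; congr out.
by elim: i => //= i ->.
Qed.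

Lemma state_fromD s x m i :
  state_from s x (m + i) = state_from (state_from s x m) (drop_digits m x) i.
Proof. by elim: i => [|i IH]; rewrite ?addn0 // addnS /= IH. Qed.

Lemma drop_digits_run s x m :
  drop_digits m (run s x) = run (state_from s x m) (drop_digits m x).
Proof. by apply/funext => i; rewrite /drop_digits /run state_fromD. Qed.

Lemma padic_modD x n m :
  padic_mod (n + m) x = padic_mod n x + p ^ n * padic_mod m (drop_digits n x).
Proof.
rewrite /padic_mod big_split_ord /= big_distrr /=; congr addn.
by apply: eq_bigr => i _; rewrite expnD mulnCA.
Qed.

Lemma padic_mod_lt n x : padic_mod n x < p ^ n.
Proof.
elim: n => [|n IH]; first by rewrite /padic_mod big_ord0.
rewrite /padic_mod big_ord_recr /= expnS.
apply: (@leq_trans ((x n).+1 * p ^ n)); first by rewrite mulSn ltn_add2r.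
by rewrite leq_mul2r ltn_ord orbT.
Qed.

Definition window n i j := exists s x,
  padic_mod n x = i /\ padic_mod n (run s x) = j.

(** Reading [n + m] digits means reading the first [n] of them, which are the
    low digits of the residues, and then the other [m] from the state thus
    reached.  It matters that windows allow an arbitrary starting state. *)
Lemma windowD n m i j : window (n + m) i j ->
  window n (i %% p ^ n) (j %% p ^ n) /\ window m (i %/ p ^ n) (j %/ p ^ n).
Proof.
have divmod y : padic_mod (n + m) y %/ p ^ n = padic_mod m (drop_digits n y) /\
    padic_mod (n + m) y %% p ^ n = padic_mod n y.
  have pn_gt0 : 0 < p ^ n by apply: leq_trans (padic_mod_lt n y).
  rewrite padic_modD addnC mulnC; split.
    by rewrite divnMDl // divn_small ?addn0 // padic_mod_lt.
  by rewrite modnMDl modn_small // padic_mod_lt.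
case=> s [x [<- <-]].
have [[-> ->] [-> ->]] := (divmod x, divmod (run s x)).
split; first by exists s, x.
by exists (state_from s x n), (drop_digits n x); rewrite drop_digits_run.
Qed.

Definition windows n : {set 'I_(p ^ n) * 'I_(p ^ n)} :=
  finset (fun w : 'I_(p ^ n) * 'I_(p ^ n) => `[< window n w.1 w.2 >]).

(** A residue modulo [p ^ (n + m)] is determined by its quotient and remainder
    by [p ^ n], so the splitting of [windowD] is injective. *)
Lemma card_windowsD n m : 0 < p ->
  #|windows (n + m)| <= #|windows n| * #|windows m|.
Proof.
move=> p_gt0.
have ltm (i : 'I_(p ^ (n + m))) : i %% p ^ n < p ^ n.
  by rewrite ltn_pmod // expn_gt0 p_gt0.
have ltd (i : 'I_(p ^ (n + m))) : i %/ p ^ n < p ^ m.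
  by rewrite ltn_divLR ?expn_gt0 ?p_gt0 // mulnC -expnD.
pose g (w : 'I_(p ^ (n + m)) * 'I_(p ^ (n + m))) :=
  ((Ordinal (ltm w.1), Ordinal (ltm w.2)),
   (Ordinal (ltd w.1), Ordinal (ltd w.2))).
have g_inj : injective g.
  move=> [i j] [i' j'] [im jm id jd]; congr pair; apply/val_inj => /=.
    by rewrite (divn_eq i (p ^ n)) im id -divn_eq.
  by rewrite (divn_eq j (p ^ n)) jm jd -divn_eq.
rewrite -cardsX -(card_imset _ g_inj); apply: subset_leq_card.
apply/fintype.subsetP => _ /imsetP[w + ->]; rewrite !finset.inE /=.
by move=> /asboolP/windowD[? ?]; apply/andP; split; apply/asboolP.
Qed.

Lemma card_windowsM m n : 0 < p -> #|windows (m * n)| <= #|windows n| ^ m.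
Proof.
move=> p_gt0; elim: m => [|m IH].
  by rewrite (leq_trans (max_card _)) // card_prod card_ord.
by rewrite mulSn expnS (leq_trans (card_windowsD _ _ _)) // leq_mul2l IH orbT.
Qed.

(** Reachability enters here: prefixing the input with a word that leads to the
    state producing a window makes this window appear in the automaton function
    itself, at the offset given by the length of that word. *)
Lemma window_automaton_fun n i j : 0 < p ->
  window n i j <-> exists m x,
    padic_mod n (drop_digits m x) = i /\
    padic_mod n (drop_digits m (automaton_fun A x)) = j.
Proof.
move=> p_gt0; split=> [[s [x [<- <-]]]|[m [x [<- <-]]]]; last first.
  exists (state_from (init A) x m), (drop_digits m x).
  by rewrite automaton_funE drop_digits_run.
have [w ->] := reachable s.
pose c0 : 'I_p := Ordinal p_gt0.
pose y i := if i < size w then nth c0 w i else x (i - size w).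
have yw : drop_digits (size w) y = x.
  by apply/funext => k; rewrite /drop_digits /y ltnNge leq_addr addKn.
exists (size w), y; rewrite automaton_funE drop_digits_run yw; split=> //.
have follow k : k <= size w ->
    state_from (init A) y k = foldl (fun t c => trans c t) (init A) (take k w).
  elim: k => [|k IH] kw; first by rewrite take0.
  by rewrite (take_nth c0 kw) -cats1 foldl_cat /= -IH 1?ltnW // /y kw.
by have := follow _ (leqnn _); rewrite take_size => ->.
Qed.

End Windows.

(** * Closed sets and rectangles in the plane *)

Section Plane.
Context (R : realType).
Notation plane_measure := (@lebesgue_measure R \x @lebesgue_measure R)%E.

(** Balls with rational centre and radius of the form [1 / (n + 1)] form a
    countable base of the plane and are products of intervals, so open sets
    belong to the product sigma-algebra. *)
Lemma open_measurable_plane (U : set (R * R)) : open U -> measurable U.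
Proof.
move=> oU.
pose B (q : rat * rat * nat) : set (R * R) :=
  ball (ratr q.1.1 : R, ratr q.1.2 : R) q.2.+1%:R^-1.
pose F q := if `[< B q `<=` U >] then B q else set0.
have mF q : measurable (F q).
  rewrite /F; case: ifP => // _.
  have -> : B q = ball (ratr q.1.1 : R) q.2.+1%:R^-1 `*`
                  ball (ratr q.1.2 : R) q.2.+1%:R^-1 by [].
  by apply: measurableX; exact: measurable_ball.
rewrite (_ : U = \bigcup_q F q); first exact: countable_bigcupT_measurable.
apply/seteqP; split=> [z Uz|z [q _]]; last first.
  by rewrite /F; case: asboolP => // BU /BU.
have /nbhs_ballP[e /= e0 eU] : nbhs z U by apply: open_nbhs_nbhs.
have e20 : 0 < e / 2 by rewrite divr_gt0.
have [n _ /(_ n (leqnn n)) ne] := near_infty_natSinv_lt (PosNum e20).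
pose d : R := n.+1%:R^-1; have de : d < e / 2 := ne.
have d0 : 0 < d by rewrite invr_gt0.
have approx (x : R) : exists q : rat, ball (ratr q : R) d x.
  have /rat_in_itvoo[q] : x - d < x + d by lra.
  rewrite in_itv /= => /andP[q1 q2]; exists q.
  by rewrite /ball /= ltr_distlC; apply/andP; split; lra.
have [[q1 q1z] [q2 q2z]] := (approx z.1, approx z.2).
exists (q1, q2, n) => //; rewrite /F; case: asboolP => [//|[]].
move=> y qy; apply: eU.
apply: (@le_ball _ _ _ (d + d)); first by lra.
by apply: ball_triangle qy; apply: ball_sym.
Qed.

Lemma closed_measurable_plane (C : set (R * R)) : closed C -> measurable C.
Proof.
move=> cC; rewrite -[C]setCK; apply: measurableC; apply: open_measurable_plane.
by rewrite openC.
Qed.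

Definition rectangle (a b c d : R) : set (R * R) := `[a, b] `*` `[c, d].

Lemma measurable_rectangle a b c d : measurable (rectangle a b c d).
Proof. exact: measurableX. Qed.

Lemma closed_rectangle a b c d : closed (rectangle a b c d).
Proof.
have -> : rectangle a b c d = fst @^-1` `[a, b] `&` snd @^-1` `[c, d] by [].
apply: closedI; apply: closed_comp; try exact: interval_closed.
  by move=> z _; exact: cvg_fst.
by move=> z _; exact: cvg_snd.
Qed.

Lemma measure_rectangle a b c d : a <= b -> c <= d ->
  plane_measure (rectangle a b c d) = ((b - a) * (d - c))%:E.
Proof.
have len (x y : R) : x <= y -> lebesgue_measure (`[x, y] : set R) = (y - x)%:E.
  rewrite lebesgue_measure_itv /= lte_fin le_eqVlt => /predU1P[->|->//].
  by rewrite ltxx subrr.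
by move=> ab cd; rewrite product_measure1E // EFinM -!len.
Qed.

Lemma measure_unit_square : plane_measure (unit_square R) = 1%E.
Proof. by rewrite (measure_rectangle ler01 ler01) subr0 mulr1. Qed.

(** Points are degenerate rectangles, which are closed of area 0. *)
Lemma finite_set_closed_null (F : set (R * R)) : finite_set F ->
  closed F /\ plane_measure F = 0%E.
Proof.
move=> finF; pose pt (z : R * R) := rectangle z.1 z.1 z.2 z.2.
have ptE z : pt z = [set z].
  rewrite /pt /rectangle !set_itv1; apply/seteqP.
  by split=> [[u v] /= [-> ->]|_ /= ->]; case: z.
have FE : F = \bigcup_(z in F) pt z.
  apply/seteqP; split=> [z Fz|z [y Fy]]; last by rewrite ptE => ->.
  by exists z => //; rewrite ptE.
have cF : closed F.
  by rewrite FE; apply: closed_bigcup => // z _; exact: closed_rectangle.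
split=> //; apply/eqP; rewrite eq_le measure_ge0 andbT.
have := @content_sub_fsum _ _ _ plane_measure _ F F pt finF.
rewrite fsbig1.
  apply; last by rewrite -FE.
    by move=> z _; exact: measurable_rectangle.
  exact: closed_measurable_plane.
by move=> z _; rewrite [LHS]measure_rectangle // !subrr mulr0.
Qed.

(** A point of the square with a neighbourhood (in the square) contained in [C]
    has, in each coordinate, a nontrivial segment of [[0, 1]] around it inside
    that neighbourhood, even when it lies on the boundary of the square.  The
    product of the two segments has positive area. *)
Lemma null_nowhere_dense_in_square (C : set (R * R)) :
  closed C -> plane_measure C = 0%E -> nowhere_dense_in (unit_square R) C.
Proof.
move=> cC C0; rewrite /nowhere_dense_in /nowhere_dense.
have /closure_id <- : closed ((set_val : unit_square R -> _) @^-1` C).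
  by apply: closed_comp cC => x _; exact: initial_continuous.
rewrite -subset0 => z /=; rewrite /interior nbhsE => -[_ [[V oV <-] Vz] VC].
have {VC} VC y : V y -> unit_square R y -> C y.
  by move=> Vy /mem_set Xy; exact: (VC (exist _ y Xy)).
have : unit_square R (set_val z) by case: z {Vz} => y Xy; exact: set_mem.
have /nbhs_ballP[e /= e0 eV] : nbhs (set_val z) V by apply: open_nbhs_nbhs.
case: (set_val z) eV => u v eV [/=]; rewrite !in_itv /=.
move=> /andP[u0 u1] /andP[v0 v1].
have segment (t : R) : 0 <= t <= 1 -> exists a b : R,
    [/\ a < b, 0 <= a, b <= 1 & forall y, a <= y <= b -> ball t e y].
  move=> /andP[t0 t1].
  exists (Num.max 0 (t - e / 2)), (Num.min 1 (t + e / 2)); split.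
  - by rewrite gt_max !lt_min; apply/andP; split; apply/andP; split; lra.
  - by rewrite le_max lexx.
  - by rewrite ge_min lexx.
  - move=> y; rewrite ge_max le_min => /andP[/andP[_ ?] /andP[_ ?]].
    by rewrite /ball /= ltr_distlC; apply/andP; split; lra.
have [|a [b [ab a0 b1 abu]]] := segment u; first by rewrite u0.
have [|c [d [cd c0 d1 cdv]]] := segment v; first by rewrite v0.
have rectC : rectangle a b c d `<=` C.
  move=> [x y] [/=]; rewrite !in_itv /= => xab ycd; apply: VC.
    by apply: eV; split; [exact: abu|exact: cdv].
  move: xab ycd => /andP[? ?] /andP[? ?].
  by split; rewrite /= in_itv /=; apply/andP; split; lra.
have := @le_measure _ _ _ plane_measure (rectangle a b c d) C.
have [mr mC] := (measurable_rectangle a b c d, closed_measurable_plane cC).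
rewrite !inE => /(_ mr mC rectC).
rewrite [leRHS]C0 [leLHS](measure_rectangle (ltW ab) (ltW cd)) lee_fin leNgt.
by rewrite mulr_gt0 ?subr_gt0.
Qed.

Lemma square_not_nowhere_dense :
  ~ nowhere_dense_in (unit_square R) (unit_square R).
Proof.
have o : unit_square R (0, 0) by split; rewrite /= in_itv /= lexx ler01.
rewrite /nowhere_dense_in /nowhere_dense => /seteqP[+ _].
move=> /(_ (exist _ (0, 0) (mem_set o))); apply.
rewrite [X in closure X](_ : _ = setT) ?closureT ?interiorT //.
by apply/seteqP; split=> // -[z Xz] _ /=; exact: set_mem.
Qed.

Lemma finite_cover_measure_le (I : finType) (D : {set I})
    (r : I -> set (R * R)) (C : set (R * R)) (m : R) :
  (forall i, closed (r i)) -> (forall i, plane_measure (r i) = m%:E) ->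
  measurable C -> C `<=` \bigcup_(i in [set i | i \in D]) r i ->
  (plane_measure C <= (m *+ #|D|)%:E)%E.
Proof.
move=> cr rm mC Cr.
have DE : [set i | i \in D] = [set` enum D].
  by apply/seteqP; split=> i /=; rewrite mem_enum.
have finD : finite_set [set i | i \in D] by rewrite DE; exact: finite_seq.
have mr i : [set i | i \in D] i -> measurable (r i).
  by move=> _; apply: closed_measurable_plane; exact: cr.
apply: le_trans (content_sub_fsum plane_measure finD mr mC Cr) _.
rewrite DE -(fsbig_seq _ _ (enum_uniq _)) /= (eq_bigr (fun=> m%:E)) //.
by rewrite big_enum /= sumEFin sumr_const.
Qed.

End Plane.

(** * Grid squares and the measure of the closed plot *)

Section Plots.
Context (R : realType) (p : nat) (p_prime : prime p).
Notation plane_measure := (@lebesgue_measure R \x @lebesgue_measure R)%E.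

Let p_gt0 : (0 < p)%N := prime_gt0 p_prime.

Let pX_gt0 n : 0 < (p ^ n)%:R :> R.
Proof. by rewrite ltr0n expn_gt0 p_gt0. Qed.

Definition box n i j : set (R * R) :=
  rectangle (i%:R / (p ^ n)%:R) (i.+1%:R / (p ^ n)%:R)
            (j%:R / (p ^ n)%:R) (j.+1%:R / (p ^ n)%:R).

Lemma measure_box n i j :
  plane_measure (box n i j) = ((p ^ n)%:R ^- 2)%:E.
Proof.
have len k : k.+1%:R / (p ^ n)%:R - k%:R / (p ^ n)%:R = (p ^ n)%:R^-1 :> R.
  by rewrite -mulrBl -natrB // subSnn mul1r.
have le k : k%:R / (p ^ n)%:R <= k.+1%:R / (p ^ n)%:R :> R.
  by rewrite -subr_ge0 len invr_ge0 ltW.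
by rewrite measure_rectangle // !len -invfM -expr2.
Qed.

(** The last [n] of the [m + n] digits are the leading digits of the plotted
    coordinate, so they locate it within a segment of length p^-n. *)
Lemma padic_mod_quot (x : padic_int p) m n
    (v := padic_mod n (drop_digits m x)) :
  v%:R / (p ^ n)%:R <= ((padic_mod (m + n) x)%:R / (p ^ (m + n))%:R : R)
    <= v.+1%:R / (p ^ n)%:R.
Proof.
rewrite padic_modD -/v expnD natrD !natrM invfM mulrA.
rewrite mulrDl [X in _ + X / _]mulrC mulfK ?gt_eqF // !ler_pM2r ?invr_gt0 //.
rewrite lerDr divr_ge0 //= -addn1 natrD addrC lerD2l ler_pdivrMr // mul1r.
by rewrite ler_nat ltnW // padic_mod_lt.
Qed.

Lemma plot_at_unit_square (f : padic_int p -> padic_int p) k :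
  plot_at R f k `<=` unit_square R.
Proof.
have unit (x : padic_int p) :
    0 <= ((padic_mod k x)%:R / (p ^ k)%:R : R) <= 1.
  by rewrite divr_ge0 //= ler_pdivrMr // mul1r ler_nat ltnW // padic_mod_lt.
by move=> _ [x _ <-]; split; rewrite /= in_itv /= unit.
Qed.

Lemma closed_plot_unit_square (f : padic_int p -> padic_int p) :
  closed_plot R f `<=` unit_square R.
Proof.
have /closure_id -> : closed (unit_square R) by exact: closed_rectangle.
by apply: closureS => z [k _ /plot_at_unit_square].
Qed.

Lemma finite_plot_at (f : padic_int p -> padic_int p) k :
  finite_set (plot_at R f k).
Proof.
pose g (w : 'I_(p ^ k) * 'I_(p ^ k)) : R * R :=
  ((w.1 : nat)%:R / (p ^ k)%:R, (w.2 : nat)%:R / (p ^ k)%:R).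
apply: (@sub_finite_set _ _ (range g)); last first.
  by apply: finite_image; exact: finite_finset.
move=> _ [x _ <-].
by exists (Ordinal (padic_mod_lt k x), Ordinal (padic_mod_lt k (f x))).
Qed.

Context (A : automaton p).
Let f := automaton_fun A.

Lemma plot_at_box k n z : (n <= k)%N -> plot_at R f k z ->
  exists2 w, w \in windows A n & box n w.1 w.2 z.
Proof.
move=> /subnK <- [x _ <-]; set m := (k - n)%N.
exists (Ordinal (padic_mod_lt n (drop_digits m x)),
        Ordinal (padic_mod_lt n (drop_digits m (f x)))).
  by rewrite finset.inE; apply/asboolP/window_automaton_fun => //; exists m, x.
by split; rewrite /= in_itv /= padic_mod_quot.
Qed.

Lemma box_plot n i j : (0 < n)%N -> window A n i j ->
  exists2 z, plot R f z & box n i j z.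
Proof.
move=> n_gt0 /(window_automaton_fun _ _ _ _ p_gt0)[m [x [<- <-]]].
exists ((padic_mod (m + n) x)%:R / (p ^ (m + n))%:R,
        (padic_mod (m + n) (f x))%:R / (p ^ (m + n))%:R).
  by exists (m + n)%N; [rewrite /= addn_gt0 n_gt0 orbT|exists x].
by split; rewrite /= in_itv /= padic_mod_quot.
Qed.

(** The squares over the windows of length [n] cover the plot except for the
    points of level below [n], a finite set that adds nothing to the measure.
    The cover is a closed set, so it covers the closure as well. *)
Lemma alpha_le n : (alpha R f <= ((p ^ n)%:R ^- 2 *+ #|windows A n|)%:E)%E.
Proof.
pose F := \bigcup_(k in `I_n) plot_at R f k.
pose G := \bigcup_(w in [set w | w \in windows A n]) box n w.1 w.2.
have finF : finite_set F.
  by apply: bigcup_finite => // k _; exact: finite_plot_at.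
have [cF F0] := finite_set_closed_null finF.
have cG : closed G.
  apply: closed_bigcup => [|w _]; first exact: finite_finset.
  exact: closed_rectangle.
have sub : closed_plot R f `<=` F `|` G.
  have /closure_id -> : closed (F `|` G) by exact: closedU.
  apply: closureS => z [k _ kz]; have [kn|nk] := ltnP k n.
    by left; exists k.
  by right; have [w] := plot_at_box nk kz; exists w.
have mF := closed_measurable_plane cF.
have mG := closed_measurable_plane cG.
have mE : measurable (closed_plot R f).
  by apply: closed_measurable_plane; exact: closed_closure.
rewrite /alpha; apply: (@le_trans _ _
    (plane_measure (F `|` G))).
  by apply: le_measure; rewrite ?inE //; exact: measurableU.
apply: (le_trans (@measureU2 _ _ _ plane_measure _ _ mF mG)).
rewrite [X in (X + _)%E]F0 add0e.
have cbox w : closed (box n (w : 'I_(p ^ n) * 'I_(p ^ n)).1 w.2).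
  exact: closed_rectangle.
exact: (finite_cover_measure_le cbox (fun w => measure_box n w.1 w.2) mG).
Qed.

(** Submultiplicativity of the number of windows makes the bound of [alpha_le]
    at length [m * n] the [m]-th power of a ratio less than 1. *)
Lemma alpha_eq0 n : (#|windows A n| < p ^ n * p ^ n)%N -> alpha R f = 0%E.
Proof.
move=> few; pose q : R := #|windows A n|%:R / (p ^ n)%:R ^+ 2.
have q0 : 0 <= q by rewrite divr_ge0 // exprn_ge0.
have q1 : q < 1.
  by rewrite ltr_pdivrMr ?exprn_gt0 // mul1r -natrX ltr_nat -mulnn.
have alphaq m : (alpha R f <= (q ^+ m)%:E)%E.
  apply: le_trans (alpha_le (m * n)) _; rewrite lee_fin -[leLHS]mulr_natl /q.
  have denE : (p ^ (m * n))%:R ^+ 2 = (p ^ n)%:R ^+ 2 ^+ m :> R.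
    by rewrite [RHS]exprAC -[in RHS]natrX -expnM mulnC.
  rewrite expr_div_n -denE ler_pM2r ?invr_gt0 ?exprn_gt0 // -natrX ler_nat.
  exact: card_windowsM.
apply/eqP; rewrite eq_le measure_ge0 andbT; apply/lee_addgt0Pr => e e0.
rewrite add0e.
have /cvgr0Pnorm_lt/(_ e e0)[m _ /(_ m (leqnn m)) qe] :
    q ^+ m @[m --> \oo] --> 0.
  by apply: cvg_expr; rewrite ger0_norm.
apply: le_trans (alphaq m) _; rewrite lee_fin ltW //.
by move: qe; rewrite ger0_norm // exprn_ge0.
Qed.

Lemma box_cover n (z : R * R) : unit_square R z ->
  exists w : 'I_(p ^ n) * 'I_(p ^ n), box n w.1 w.2 z.
Proof.
have cell (t : R) : 0 <= t <= 1 -> exists i : 'I_(p ^ n),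
    i%:R / (p ^ n)%:R <= t <= i.+1%:R / (p ^ n)%:R.
  (* The endpoint 1 belongs to the last cell, whose index is not the integer
     part of [t * p ^ n]. *)
  move=> /andP[t0]; rewrite le_eqVlt => /predU1P[->|t1].
    have lt : ((p ^ n).-1 < p ^ n)%N by rewrite prednK ?expn_gt0 ?p_gt0.
    exists (Ordinal lt) => /=; rewrite prednK ?expn_gt0 ?p_gt0 //.
    rewrite divff ?gt_eqF // lexx andbT ler_pdivrMr // mul1r.
    by rewrite ler_nat leq_pred.
  have tp0 : 0 <= t * (p ^ n)%:R by rewrite mulr_ge0.
  have /andP[le lt] := truncn_itv tp0.
  have ltp : (Num.truncn (t * (p ^ n)%:R) < p ^ n)%N.
    by rewrite -(ltr_nat R) (le_lt_trans le) // gtr_pMl.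
  by exists (Ordinal ltp); rewrite /= ler_pdivrMr // ler_pdivlMr // le ltW.
case: z => u v [/= ]; rewrite !in_itv /= => /cell[i ui] /cell[j vj].
by exists (i, j); split; rewrite /= in_itv.
Qed.

(** A point of the square and some plotted point share a grid square of
    arbitrarily small side. *)
Lemma closed_plot_full : (forall n, #|windows A n| = p ^ n * p ^ n)%N ->
  closed_plot R f = unit_square R.
Proof.
move=> full; apply/seteqP; split=> [|z Xz].
  exact: closed_plot_unit_square.
have allw n (w : 'I_(p ^ n) * 'I_(p ^ n)) : window A n w.1 w.2.
  have /eqP wT : windows A n == [set: _]%SET.
    by rewrite finset.eqEcard finset.subsetT /= cardsT card_prod card_ord full.
  by have := finset.in_setT w; rewrite -wT finset.inE => /asboolP.
move=> V /nbhs_ballP[e /= e0 eV].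
have [n n_gt0 ne] : exists2 n, (0 < n)%N & (p ^ n)%:R^-1 < e.
  have [m _ /(_ m (leqnn m)) me] := near_infty_natSinv_lt (PosNum e0).
  exists m.+1 => //; apply: le_lt_trans me => /=.
  rewrite lef_pV2 ?posrE // ler_nat.
  exact: ltnW (ltn_expl _ (prime_gt1 p_prime)).
have [w [zw1 zw2]] := box_cover n Xz.
have [y py [yw1 yw2]] := box_plot n_gt0 (allw n w).
have near i (s t : R) : i%:R / (p ^ n)%:R <= s <= i.+1%:R / (p ^ n)%:R ->
    i%:R / (p ^ n)%:R <= t <= i.+1%:R / (p ^ n)%:R -> ball s e t.
  rewrite -addn1 natrD mulrDl mul1r => /andP[? ?] /andP[? ?].
  by rewrite /ball /= ltr_distlC; apply/andP; split; lra.
exists y; split=> //; apply: eV.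
by split; [apply: (near w.1)|apply: (near w.2)].
Qed.

Lemma alpha_dichotomy : alpha R f = 0%E \/ closed_plot R f = unit_square R.
Proof.
have [[n few]|full] := pselect (exists n, #|windows A n| < p ^ n * p ^ n)%N.
  by left; exact: alpha_eq0 few.
right; apply: closed_plot_full => n; apply/eqP; rewrite eqn_leq.
rewrite (leq_trans (max_card _)) ?card_prod ?card_ord //= leqNgt.
by apply/negP => few; apply: full; exists n.
Qed.

End Plots.

Theorem theorem4p1 (R : realType) (p : nat) (p_prime : prime p)
    (A : automaton p) :
  let f := automaton_fun A in
  [/\ alpha R f = 0%E \/ alpha R f = 1%E,
      alpha R f = 0%E <-> nowhere_dense_in (unit_square R) (closed_plot R f)
    & alpha R f = 1%E <-> closed_plot R f = unit_square R].
Proof.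
move=> f; have square1 : closed_plot R f = unit_square R -> alpha R f = 1%E.
  by rewrite /alpha => ->; exact: measure_unit_square.
have dich := alpha_dichotomy R p_prime A; split.
- by case: dich => [|/square1]; [left|right].
- split=> [a0|nd].
    by apply: null_nowhere_dense_in_square => //; exact: closed_closure.
  case: dich => // E; rewrite /f E in nd.
  by case: (square_not_nowhere_dense nd).
- split=> [a1|]; last exact: square1.
  case: dich => // a0; move: a1; rewrite /f a0 => /eqP.
  by rewrite eq_sym onee_eq0.
Qed.
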